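(* Let $s\geq 2$ and $q\geq 0$ be integers and put $Q=q+\binom{s}{2}$. If ${\rm ex}_{\Pi}(s,Q)>1$, then $$ {\rm ex}_{\Pi}(s,Q)^{\binom{n}{2}}\leq |F(n,s,q)|\leq {\rm ex}_{\Pi}(s,Q)^{(1+o(1))\binom{n}{2}} $$ as $n\to\infty$; and if ${\rm ex}_{\Pi}(s,Q)\leq 1$, then $|F(n,s,q)|\leq 2^{o(n^2)}$.
   Context: A multigraph is a pair $(V,w)$ with $V$ a set and $w:\binom{V}{2}\to\mathbb{N}=\{0,1,2,\dots\}$. For integers $s\ge 2$, $q\ge 0$, a multigraph $(V,w)$ is an $(s,q)$-graph if for every $s$-element $X\subseteq V$, $\sum_{xy\in\binom{X}{2}}w(xy)\le q$. $F(n,s,q)$ is the set of $(s,q)$-graphs with vertex set $[n]=\{1,\dots,n\}$. For $G=(V,w)$ let $P(G)=\prod_{xy\in\binom{V}{2}}w(xy)$. Define ${\rm ex}_{\Pi}(n,s,q)=\max\{P(G):G\in F(n,s,q)\}$ and ${\rm ex}_{\Pi}(s,q)=\lim_{n\to\infty}{\rm ex}_{\Pi}(n,s,q)^{1/\binom{n}{2}}$ (this limit exists). *)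

(* Defs.v *)
From HB Require Import structures.
From mathcomp Require Import all_boot all_order all_algebra.
From mathcomp Require Import finmap.
From mathcomp Require Import all_classical all_reals all_analysis.

Set Implicit Arguments.
Unset Strict Implicit.
Unset Printing Implicit Defensive.

Import Order.TTheory GRing.Theory Num.Theory.
Import numFieldNormedType.Exports.

Local Open Scope classical_set_scope.
Local Open Scope ring_scope.

Definition vpair (V : finType) := {e : {set V} | #|e| == 2%N}.

Definition multigraph (V : finType) := {ffun vpair V -> nat}.

Definition is_sq_graph (V : finType) (s q : nat) (w : multigraph V) : Prop :=
  forall X : {set V}, #|X| = s ->
    (\sum_(e : vpair V | val e \subset X) w e <= q)%N.

Definition sq_graphs (n s q : nat) : set (multigraph 'I_n) :=
  [set w | is_sq_graph s q w].
Arguments sq_graphs : clear implicits.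

Definition weight_prod (V : finType) (w : multigraph V) : nat :=
  (\prod_(e : vpair V) w e)%N.

(* Any pair lies in some s-set, so every weight is at most q. *)
Lemma sq_graphs_finite (n s q : nat) :
  (2 <= s)%N -> (s <= n)%N -> finite_set (sq_graphs n s q).
Proof.
move=> s2 sn.
pose S : set (multigraph 'I_n) :=
  range (fun f : {ffun vpair 'I_n -> 'I_q.+1} =>
           [ffun e => nat_of_ord (f e)] : multigraph 'I_n).
apply: (@sub_finite_set _ _ S); last by apply: finite_image; exact: finite_finset.
move=> w wsq; have wq (e : vpair 'I_n) : (w e < q.+1)%N.
  have e2 : #|val e| = 2%N by apply/eqP; exact: (valP e).
  have [X [eX Xs]] : exists X : {set 'I_n}, val e \subset X /\ #|X| = s.
    have : (#|val e| <= s)%N by rewrite e2.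
    elim: s s2 sn {wsq} => // k IH _ kn.
    rewrite leq_eqVlt => /orP[/eqP <-|ek]; first by exists (val e).
    have k2 : (2 <= k)%N by rewrite -e2.
    have [X [eX Xk]] := IH k2 (ltnW kn) ek.
    have /set0Pn[x xX] : ~: X != finset.set0.
      by rewrite -card_gt0 cardsCs finset.setCK card_ord Xk subn_gt0.
    exists (x |: X); split; first exact: (fintype.subset_trans eX (finset.subsetUr _ _)).
    by move: xX; rewrite inE => xX; rewrite cardsU1 xX Xk.
  rewrite ltnS; apply: leq_trans (wsq X Xs).
  by rewrite (bigD1 e)//= leq_addr.
exists [ffun e => Ordinal (wq e)] => //.
by apply/ffunP => e; rewrite !ffunE.
Qed.

(* For 2 <= n < s, sq_graphs n s q is infinite, the maximum does not exist and
   fset_set makes this 0; only large n matter for the limit below. *)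
Definition exPi_n (n s q : nat) : nat :=
  (\max_(w <- fset_set (sq_graphs n s q)) weight_prod w)%N.

Definition exPi (R : realType) (s q : nat) : R :=
  limn (fun n : nat => (exPi_n n s q)%:R `^ ('C(n, 2)%:R)^-1 : R).
Arguments exPi : clear implicits.

(* Main.v *)
Require Import Defs.
From HB Require Import structures.
From mathcomp Require Import all_boot all_order all_algebra.
From mathcomp Require Import finmap.
From mathcomp Require Import all_classical all_reals all_analysis.
From mathcomp Require Import fintype finset bigop ring lra zify.
Import Order.TTheory GRing.Theory Num.Theory.
Import numFieldNormedType.Exports.
Local Open Scope ring_scope.
Set Implicit Arguments.
Unset Strict Implicit.
Unset Printing Implicit Defensive.

(* Subtracting 1 from all weights turns a Q-extremal graph G with P(G) > 0 into
   an element of F(n, s, q) dominating P(G) others: this is the lower bound, as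
   ex_Pi(n, s, Q)^(1 / C(n, 2)) is nonincreasing by averaging over vertex
   deletions.
   For the upper bound let W be uniform on F(n, s, q). Since W is exchangeable,
   the entropy g(m) of one pair given all the other pairs in a set of m vertices
   depends only on m, decreases with m, and satisfies
   ln |F(n, s, q)| <= C(n, 2) g(m) + O(m n). Choose t with g(t + 2) - g(t + k)
   small and condition on the pairs meeting a set T of t vertices: the C(k, 2)
   pairs inside a disjoint k-set then become almost independent, so that
   typically every combination of their likely values does occur. As F(k, s, q)
   contains all of these combinations, the product of the numbers of likely
   values is at most ex_Pi(k, s, Q), hence
   C(k, 2) g(t + k) <= ln ex_Pi(k, s, Q) + o(1). *)

(** * Conditional entropy of a uniform element, through fibre sizes *)

(** For [w] uniform on [Omega], [fiber Z w / #|Omega|] is the probability of the value [Z w]. Hence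
    sums over [w] of logarithms of quotients of fibre sizes are conditional entropies, scaled by
    [#|Omega|]. *)
Definition fiber (Omega T : finType) (Z : Omega -> T) (w : Omega) : nat :=
  #|[pred u | Z u == Z w]|.

Definition joint (Omega T U : finType) (Z : Omega -> T) (X : Omega -> U) w := (Z w, X w).

Section Entropy.
Variables (R : realType) (Omega : finType).

Lemma fiber_gt0 (T : finType) (Z : Omega -> T) w : (0 < fiber Z w)%N.
Proof. by apply/card_gt0P; exists w; rewrite inE. Qed.

Lemma fiberR_gt0 (T : finType) (Z : Omega -> T) w : (0 : R) < (fiber Z w)%:R.
Proof. by rewrite ltr0n fiber_gt0. Qed.

Lemma eq_fiber (T T' : finType) (Z : Omega -> T) (Z' : Omega -> T') :
  (forall u v, (Z u == Z v) = (Z' u == Z' v)) -> fiber Z =1 fiber Z'.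
Proof. by move=> ZZ' w; apply: eq_card => u; rewrite !inE ZZ'. Qed.

Lemma leq_fiber_joint (T U : finType) (Z : Omega -> T) (X : Omega -> U) w :
  (fiber (joint Z X) w <= fiber Z w)%N.
Proof.
by apply: subset_leq_card; apply/fintype.subsetP => u; rewrite !inE xpair_eqE => /andP[].
Qed.

Lemma ln_le_subr1 (x : R) : 0 < x -> ln x <= x - 1.
Proof. by move=> x0; rewrite -{1}(subrKC 1 x) le_ln1Dx // ltrBDr addNr. Qed.

Lemma ln_prod (I : finType) (P : pred I) (F : I -> R) : (forall i, P i -> 0 < F i) ->
  ln (\prod_(i | P i) F i) = \sum_(i | P i) ln (F i).
Proof.
move=> F0; suff [] : 0 < \prod_(i | P i) F i /\
    ln (\prod_(i | P i) F i) = \sum_(i | P i) ln (F i) by [].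
apply: (big_rec2 (fun x y => 0 < x /\ ln x = y)); first by rewrite ln1.
by move=> i y x Pi [x0 <-]; rewrite mulr_gt0 ?lnM ?posrE ?F0.
Qed.

Definition occurs (T U : finType) (Z : Omega -> T) (X : Omega -> U) (z : T) (x : U) :=
  [exists w, (Z w == z) && (X w == x)].

(** Change of measure: the second factor is the inverse of the conditional probability of [X w]
    given [Z w], so an average over [X] becomes a plain sum over the values compatible with
    [Z w]. *)
Lemma sum_fiber (T U : finType) (Z : Omega -> T) (X : Omega -> U) (h : T -> U -> R) :
  \sum_w h (Z w) (X w) * ((fiber Z w)%:R / (fiber (joint Z X) w)%:R) =
  \sum_w \sum_(x | occurs Z X (Z w) x) h (Z w) x.
Proof.
transitivity (\sum_w \sum_(u | Z u == Z w)
    h (Z w) (X w) / (fiber (joint Z X) w)%:R).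
  apply: eq_bigr => w _; rewrite sumr_const -[RHS]mulr_natr mulrA mulrAC.
  by congr (_ * _%:R); apply: eq_card => u; rewrite inE.
rewrite (exchange_big_dep predT) //=; apply: eq_bigr => u _.
rewrite (partition_big X (occurs Z X (Z u))) /=; last first.
  by move=> w zw; apply/existsP; exists w; rewrite eq_sym zw eqxx.
apply: eq_bigr => x /existsP[v /andP[/eqP zv /eqP xv]].
rewrite (eq_bigr (fun=> h (Z u) x / (fiber (joint Z X) v)%:R)); last first.
  move=> w /andP[/eqP zw /eqP xw]; rewrite -zw xw; congr (_ / _%:R).
  by apply: eq_card => w'; rewrite !inE /joint zv zw xv xw.
rewrite sumr_const -[LHS]mulr_natr -mulrA -[RHS]mulr1; congr (_ * _).
rewrite (_ : #|_| = fiber (joint Z X) v) ?mulVf ?pnatr_eq0 -?lt0n ?fiber_gt0//.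
by apply: eq_card => w; rewrite !inE xpair_eqE zv xv eq_sym.
Qed.

Definition cond (T U : finType) (Z : Omega -> T) (X : Omega -> U) (z : T) (x : U) : R :=
  #|[pred w | (Z w == z) && (X w == x)]|%:R / #|[pred w | Z w == z]|%:R.

Lemma cond_ge0 (T U : finType) (Z : Omega -> T) (X : Omega -> U) z x :
  0 <= cond Z X z x.
Proof. by rewrite divr_ge0. Qed.

Lemma condE (T U : finType) (Z : Omega -> T) (X : Omega -> U) w :
  cond Z X (Z w) (X w) = (fiber (joint Z X) w)%:R / (fiber Z w)%:R.
Proof.
by congr (_%:R / _); apply: eq_card => u; rewrite !inE xpair_eqE.
Qed.

Lemma sum_cond (T U : finType) (Z : Omega -> T) (X : Omega -> U) w :
  \sum_x cond Z X (Z w) x = 1.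
Proof.
rewrite -mulr_suml -natr_sum.
have -> : (\sum_x #|[pred u | (Z u == Z w) && (X u == x)]| = fiber Z w)%N.
  rewrite /fiber -sum1_card (partition_big X predT) //=; apply: eq_bigr => x _.
  by rewrite -sum1_card; apply: eq_bigl => u; rewrite inE.
by rewrite divff // gt_eqF // fiberR_gt0.
Qed.

(* The right-hand side is, up to normalisation, the relative entropy of the law
   of [X] with respect to the product of its marginals, conditionally on [Z]. *)
Lemma missing_mass_le (T V I : finType) (Z : Omega -> T) (X : Omega -> {ffun I -> V}) :
  \sum_w \sum_(x | ~~ occurs Z X (Z w) x)
      \prod_i cond Z (fun u => X u i) (Z w) (x i) <=
  \sum_w (\sum_i ln ((fiber Z w)%:R / (fiber (joint Z (fun u => X u i)) w)%:R)
          - ln ((fiber Z w)%:R / (fiber (joint Z X) w)%:R)).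
Proof.
pose h z (x : {ffun I -> V}) := \prod_i cond Z (fun u => X u i) z (x i).
have E w : \sum_(x | ~~ occurs Z X (Z w) x) h (Z w) x =
    1 - \sum_(x | occurs Z X (Z w) x) h (Z w) x.
  have : \sum_x h (Z w) x = 1.
    rewrite /h -(bigA_distr_bigA (fun i => cond Z (fun u => X u i) (Z w))).
    by rewrite big1 // => i _; rewrite sum_cond.
  by rewrite (bigID (occurs Z X (Z w))) /= => <-; rewrite addrAC subrr add0r.
(* The product law has total mass 1, and by [sum_fiber] its mass on occurring values is the sum of
   its density against the joint law. What remains is [1 - y <= - ln y] at that density. *)
rewrite (eq_bigr _ (fun w _ => E w)) sumrB -sum_fiber -sumrB.
apply: ler_sum => w _.
have Zw := fiberR_gt0 Z w; have ZXw := fiberR_gt0 (joint Z X) w.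
have c0 i : 0 < cond Z (fun u => X u i) (Z w) (X w i).
  by rewrite condE divr_gt0 // fiberR_gt0.
have -> : \sum_i ln ((fiber Z w)%:R / (fiber (joint Z (fun u => X u i)) w)%:R)
     - ln ((fiber Z w)%:R / (fiber (joint Z X) w)%:R) =
   - ln (h (Z w) (X w) * ((fiber Z w)%:R / (fiber (joint Z X) w)%:R)) :> R.
  rewrite lnM ?posrE ?divr_gt0 ?prodr_gt0// opprD; congr (_ - _).
  rewrite /h ln_prod // -sumrN; apply: eq_bigr => i _.
  by rewrite condE -lnV ?posrE ?divr_gt0 ?fiberR_gt0// invf_div.
rewrite -opprB lerN2 ln_le_subr1// mulr_gt0 ?prodr_gt0// divr_gt0//.
Qed.

(** Conditional mutual information is nonnegative: this is [missing_mass_le] for the two-coordinate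
    family [X], [Y], whose left side is a sum of nonnegative terms. *)
Lemma ln_submod (T V : finType) (Z : Omega -> T) (X Y : Omega -> V) :
  \sum_w ln ((fiber (joint Z Y) w)%:R / (fiber (joint Z (joint X Y)) w)%:R : R) <=
  \sum_w ln ((fiber Z w)%:R / (fiber (joint Z X) w)%:R).
Proof.
pose XY w : {ffun bool -> V} := [ffun b => if b then X w else Y w].
have := missing_mass_le Z XY.
have E1 b : fiber (joint Z (fun u => XY u b)) =1 fiber (joint Z (if b then X else Y)).
  by apply: eq_fiber => u v; rewrite !xpair_eqE !ffunE; case: b.
have E2 : fiber (joint Z XY) =1 fiber (joint Z (joint X Y)).
  apply: eq_fiber => u v; rewrite !xpair_eqE; congr (_ && _).
  apply/eqP/andP=> [/ffunP e|[/eqP e1 /eqP e2]]; last first.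
    by apply/ffunP => b; rewrite !ffunE; case: b.
  by have := e true; have := e false; rewrite !ffunE => -> ->.
under [X in _ <= X -> _]eq_bigr => w _ do
  rewrite big_bool /= !E1 E2 !ln_div ?posrE ?fiberR_gt0//.
have p0 : 0 <= \sum_w \sum_(x | ~~ occurs Z XY (Z w) x)
      \prod_i cond Z (fun u => XY u i) (Z w) (x i).
  rewrite sumr_ge0 // => w _; rewrite sumr_ge0 // => x _.
  by rewrite prodr_ge0 // => i _; rewrite cond_ge0.
move=> /(le_trans p0) H; rewrite -subr_ge0 -sumrB; apply: le_trans H _.
apply: ler_sum => w _; rewrite !ln_div ?posrE ?fiberR_gt0//; lra.
Qed.

Definition likely (T U : finType) (Z : Omega -> T) (X : Omega -> U) (d : R) z :=
  #|[pred x | d <= cond Z X z x]|.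

Lemma ln_le_sqrt (x : R) : 0 < x -> ln x <= 2 * Num.sqrt x.
Proof.
move=> x0; rewrite -{1}(sqr_sqrtr (ltW x0)) lnXn ?sqrtr_gt0// -[X in X <= _]mulr_natl.
by rewrite ler_pM2l // (le_trans (ln_le_subr1 _)) ?sqrtr_gt0// lerBlDr lerDl.
Qed.

(* Gibbs' inequality against the uniform law on the likely values, the unlikely
   ones contributing at most [- p ln p <= 2 sqrt p] each. *)
Lemma ln_fiber_le_likely (T U : finType) (Z : Omega -> T) (X : Omega -> U) (d : R) :
  0 < d ->
  \sum_w ln ((fiber Z w)%:R / (fiber (joint Z X) w)%:R) <=
  \sum_w (ln (likely Z X d (Z w))%:R + #|U|%:R * (d + 2 * Num.sqrt d)).
Proof.
move=> d0.
pose r w : R := (fiber Z w)%:R / (fiber (joint Z X) w)%:R.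
have r0 w : 0 < r w by rewrite divr_gt0 // fiberR_gt0.
have rV w : cond Z X (Z w) (X w) = (r w)^-1 by rewrite condE invf_div.
pose A z x := d <= cond Z X z x.
have lik0 w : A (Z w) (X w) -> (0 : R) < (likely Z X d (Z w))%:R.
  by move=> Aw; rewrite ltr0n; apply/card_gt0P; exists (X w).
pose g z x : R := if A z x then (likely Z X d z)%:R^-1 else 0.
have g0 z x : 0 <= g z x by rewrite /g; case: ifP => // _; rewrite invr_ge0.
have s0 : 0 <= d + 2 * Num.sqrt d.
  by rewrite addr_ge0 ?mulr_ge0 ?sqrtr_ge0// ltW.
(* At a likely value, [ln (r / m) <= r / m - 1] with [m] the number of likely values. At an unlikely
   one [1 < d * r], which absorbs the [- 1] and also gives [ln r <= 2 sqrt r <= 2 sqrt d * r]. *)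
have P w : ln (r w) <= ln (likely Z X d (Z w))%:R +
    (g (Z w) (X w) * r w - 1) + (d + 2 * Num.sqrt d) * r w.
  rewrite /g; case: ifPn => [Aw|].
    have m0 := lik0 _ Aw; rewrite -[X in X <= _]addr0 lerD //; last first.
      by rewrite mulr_ge0 // ltW.
    rewrite -lerBlDl -ln_div ?posrE// mulrC.
    by apply: ln_le_subr1; rewrite mulr_gt0 ?invr_gt0.
  rewrite -ltNge rV => rd; have dr : 1 < d * r w.
    by rewrite -ltr_pdivrMr // div1r.
  rewrite mul0r sub0r mulrDl -addrA ler_wpDl //.
    case: (likely Z X d (Z w)) => [|m]; first by rewrite ln0.
    by rewrite ln_ge0 // ler1n.
  apply: (le_trans (ln_le_sqrt (r0 w))); rewrite addrA ler_wpDl //.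
    by rewrite addrC subr_ge0 ltW.
  rewrite -mulrA ler_pM2l // -{2}(sqr_sqrtr (ltW (r0 w))) expr2 mulrA.
  by rewrite ler_peMl ?sqrtr_ge0// -sqrtrM ?(ltW d0)// -[X in X <= _]sqrtr1 ler_wsqrtr // ltW.
apply: le_trans (ler_sum _ (fun w _ => P w)) _.
rewrite !big_split /= -addrA lerD2l.
rewrite sumrN.
rewrite -mulr_sumr.
rewrite [X in _ <= X](_ : _ = (d + 2 * Num.sqrt d) * \sum_(w : Omega) #|U|%:R);
  last first.
  by rewrite mulr_sumr; apply: eq_bigr => w _; rewrite mulrC.
rewrite -[X in _ <= X]add0r lerD //.
  (* By [sum_fiber] the [g]-terms add up to at most 1 per [w], as [g z] has total mass at most 1;
     below, the sum of [r] is likewise at most [#|U|] per [w]. *)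
  rewrite subr_le0 sum_fiber; apply: ler_sum => w _.
  apply: (@le_trans _ _ (\sum_x g (Z w) x)).
    by rewrite [X in _ <= X](bigID (occurs Z X (Z w))) /= lerDl sumr_ge0.
  rewrite -big_mkcond /= sumr_const -[X in X <= _]mulr_natr.
  have [->|] := eqVneq (#|[pred x | A (Z w) x]|) 0%N; first by rewrite mulr0.
  by move=> n0; rewrite mulVf // pnatr_eq0.
rewrite ler_wpM2l //.
under eq_bigr do rewrite -[r _]mul1r.
rewrite (sum_fiber Z X (fun _ _ => 1)); apply: ler_sum => w _.
by rewrite sumr_const ler_nat max_card.
Qed.

(** Gibbs' inequality against the uniform law on [U]. *)
Lemma ln_fiber_le (T U : finType) (Z : Omega -> T) (X : Omega -> U) :
  \sum_w ln ((fiber Z w)%:R / (fiber (joint Z X) w)%:R) <=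
  #|Omega|%:R * ln #|U|%:R :> R.
Proof.
have -> : #|Omega|%:R * ln #|U|%:R = \sum_(w : Omega) ln #|U|%:R :> R.
  by rewrite sumr_const -[RHS]mulr_natl.
rewrite -subr_ge0 -sumrB.
apply: (@le_trans _ _ (\sum_w (1 - #|U|%:R^-1 * ((fiber Z w)%:R / (fiber (joint Z X) w)%:R)))).
  rewrite sumrB subr_ge0 (sum_fiber Z X (fun _ _ => #|U|%:R^-1)).
  apply: ler_sum => w _; rewrite sumr_const -[X in X <= _]mulr_natr mulrC.
  have U0 : (0 : R) < #|U|%:R by rewrite ltr0n; apply/card_gt0P; exists (X w).
  by rewrite ler_pdivrMr // mul1r ler_nat max_card.
apply: ler_sum => w _.
have U0 : (0 : R) < #|U|%:R by rewrite ltr0n; apply/card_gt0P; exists (X w).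
have r0 : (0 : R) < (fiber Z w)%:R / (fiber (joint Z X) w)%:R by rewrite divr_gt0 // fiberR_gt0.
have := ln_le_subr1 (divr_gt0 r0 U0); rewrite ln_div ?posrE// [_^-1 * _]mulrC.
by move=> h; rewrite -lerN2 !opprB.
Qed.
End Entropy.

(** * Submodularity *)

Lemma set_ind_setU1 (T : finType) (P : {set T} -> Prop) : P finset.set0 ->
  (forall x (A : {set T}), x \notin A -> P A -> P (x |: A)) -> forall A, P A.
Proof.
move=> P0 PU A; have [n] := ubnP #|A|; elim: n A => // n IH A An.
have [->//|/set0Pn[x xA]] := eqVneq A finset.set0.
rewrite -(finset.setD1K xA); apply: PU; rewrite ?inE ?eqxx//; apply: IH.
by move: An; rewrite (cardsD1 x) xA.
Qed.

Section Submodular.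
Variables (R : realType) (E : finType) (f : {set E} -> R).
Hypothesis fS : forall A B X : {set E}, A \subset B ->
  f (B :|: X) - f B <= f (A :|: X) - f A.

(** Add the elements of [K] one at a time: each increment is at most the increment over [D]
    alone. *)
Lemma submod_sum_ge (D K : {set E}) :
  f (D :|: K) - f D <= \sum_(e in K) (f (e |: D) - f D).
Proof.
elim/set_ind_setU1: K => [|e K eK IH]; first by rewrite finset.setU0 subrr big_set0.
rewrite big_setU1 //= [e |: K]finset.setUC finset.setUA.
have := fS [set e] (finset.subsetUl D K); rewrite [D :|: [set e]]finset.setUC; lra.
Qed.

(** Dually, each increment is at least the one obtained when the element is added last. *)
Lemma submod_sum_le (D K : {set E}) : [disjoint K & D] ->
  \sum_(e in K) (f (D :|: K) - f ((D :|: K) :\ e)) <= f (D :|: K) - f D.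
Proof.
move=> dKD; pose F := D :|: K; rewrite -/F.
(* Only the range of summation varies in the induction; the increments stay those at the full set
   [F]. *)
suff H (J : {set E}) : J \subset K ->
    \sum_(e in J) (f F - f (F :\ e)) <= f (D :|: J) - f D by apply: H.
elim/set_ind_setU1: J => [|e J eJ IH] JK; first by rewrite finset.setU0 subrr big_set0.
rewrite big_setU1 //= [e |: J]finset.setUC finset.setUA.
have eK : e \in K by rewrite (fintype.subsetP JK) // !inE eqxx.
have {}JK : J \subset K by apply: fintype.subset_trans JK; apply: finset.subsetUr.
have eD : e \notin D by rewrite (disjointFr dKD).
have sub : D :|: J \subset F :\ e.
  apply/fintype.subsetP => x; rewrite !inE => /orP[xD|xJ].
    by rewrite xD andbT; apply: contraNneq eD => <-.
  by rewrite (fintype.subsetP JK) // orbT andbT; apply: contraNneq eJ => <-.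
have := fS [set e] sub; rewrite [F :\ e :|: _]finset.setUC finset.setD1K ?inE ?eK ?orbT//.
by have := IH JK; lra.
Qed.
End Submodular.

(** * Entropy of the restrictions of a uniform function *)

Section RestrictionEntropy.
Variables (R : realType) (E V : finType) (B : {set {ffun E -> V}}).

(** Coordinates outside [S] are erased to [None], so that all restrictions share one type, as
    [ln_submod] requires of its two variables. *)
Definition res (S : {set E}) (w : {w | w \in B}) : {ffun E -> option V} :=
  [ffun e => if e \in S then Some (val w e) else None].

Lemma res_eq (S : {set E}) u v :
  (res S u == res S v) = [forall e in S, val u e == val v e].
Proof.
apply/eqP/forall_inP => [/ffunP uv e eS|uv].
  by have := uv e; rewrite !ffunE eS => -[->].
by apply/ffunP => e; rewrite !ffunE; case: ifP => // /uv /eqP ->.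
Qed.

Lemma fiber_resU (S S' : {set E}) :
  fiber (joint (res S) (res S')) =1 fiber (res (S :|: S')).
Proof.
apply: eq_fiber => u v; rewrite xpair_eqE !res_eq.
apply/andP/forall_inP => [[/forall_inP h /forall_inP h'] e|h].
  by rewrite inE => /orP[]; [apply: h|apply: h'].
by split; apply/forall_inP => e eS; apply: h; rewrite inE eS ?orbT.
Qed.

Lemma fiber_res1 (S : {set E}) (e : E) :
  fiber (joint (res S) (fun w => val w e)) =1 fiber (res (e |: S)).
Proof.
move=> w; rewrite finset.setUC -fiber_resU; move: w; apply: eq_fiber => u v.
rewrite !xpair_eqE; congr (_ && _); rewrite res_eq.
apply/idP/forall_inP => [uv x|]; first by rewrite inE => /eqP ->.
by apply; rewrite inE.
Qed.

(* Up to an additive constant and the factor [#|B|], the entropy of the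
   restriction to [S] of a uniformly random element of [B]. *)
Definition rentropy (S : {set E}) : R := - \sum_w ln (fiber (res S) w)%:R.

Lemma rentropyB (S S' : {set E}) : 
  rentropy S' - rentropy S = \sum_w ln ((fiber (res S) w)%:R / (fiber (res S') w)%:R).
Proof.
rewrite /rentropy opprK addrC -sumrB; apply: eq_bigr => w _.
by rewrite ln_div ?posrE ?fiberR_gt0.
Qed.

Lemma rentropy_submod (A C X : {set E}) : A \subset C ->
  rentropy (C :|: X) - rentropy C <= rentropy (A :|: X) - rentropy A.
Proof.
move=> AC; rewrite !rentropyB; have := ln_submod R (res A) (res X) (res C).
under eq_bigr => w _ do rewrite fiber_resU (finset.setUidPr AC).
under [X in _ <= X -> _]eq_bigr => w _ do rewrite fiber_resU.
congr (_ <= _); apply: eq_bigr => w _; congr (ln (_ / _%:R)).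
move: w; apply: eq_fiber => u v; rewrite !xpair_eqE !res_eq.
apply/and3P/forall_inP => [[_ /forall_inP h /forall_inP h'] e|h].
  by rewrite inE => /orP[]; [apply: h'|apply: h].
split; apply/forall_inP => e eS; apply: h; rewrite inE ?eS ?orbT//.
by rewrite (fintype.subsetP AC).
Qed.

Lemma le_rentropy (S S' : {set E}) : S \subset S' -> rentropy S <= rentropy S'.
Proof.
move=> SS'; rewrite -subr_ge0 rentropyB sumr_ge0 // => w _.
rewrite ln_ge0 // ler_pdivlMr ?fiberR_gt0// mul1r ler_nat.
rewrite -(finset.setUidPr SS') -fiber_resU; exact: leq_fiber_joint.
Qed.

Lemma rentropyU1_le (S : {set E}) e :
  rentropy (e |: S) - rentropy S <= #|B|%:R * ln #|V|%:R.
Proof.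
rewrite rentropyB; have := ln_fiber_le R (res S) (fun w => val w e).
by rewrite card_sig; under eq_bigr => w _ do rewrite fiber_res1.
Qed.

(** With [rentropyT] this fixes the normalisation: the total increase from the empty set to the full
    set is [#|B| * ln #|B|], the quantity to be bounded. *)
Lemma rentropy0 : rentropy finset.set0 = - (#|B|%:R * ln #|B|%:R).
Proof.
rewrite /rentropy; congr (- _); rewrite (eq_bigr (fun=> ln #|B|%:R)).
  by rewrite sumr_const cardT -cardE card_sig -[LHS]mulr_natl.
move=> w _; congr (ln _%:R); rewrite /fiber -[RHS]card_sig; apply: eq_card => u.
by rewrite !inE res_eq; apply/forall_inP => e; rewrite inE.
Qed.

Lemma rentropyT : rentropy finset.setT = 0.
Proof.
rewrite /rentropy big1 ?oppr0// => w _; rewrite (_ : fiber _ _ = 1%N) ?ln1//.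
rewrite -(card1 w); apply: eq_card => u; rewrite !inE res_eq.
apply/forall_inP/eqP => [h|-> //]; apply: val_inj; apply/ffunP => e.
by apply/eqP; apply: h; rewrite inE.
Qed.

(** Source of exchangeability: precomposition with [p] is an injective self-map of the finite set
    [B], hence a bijection, and it matches the fibres over [p @: S] with those over [S]. *)
Lemma rentropy_imset (p : E -> E) (S : {set E}) : injective p ->
  (forall w, w \in B -> [ffun e => w (p e)] \in B) -> rentropy (p @: S) = rentropy S.
Proof.
move=> pI pB.
pose m (w : {w | w \in B}) : {w | w \in B} := exist (fun w => w \in B) _ (pB _ (valP w)).
have mE w e : val (m w) e = val w (p e) by rewrite /= ffunE.
have mI : injective m.
  move=> u v /(congr1 val) /ffunP uv; apply: val_inj; apply/ffunP => e.
  by have := uv (invF pI e); rewrite !mE f_invF.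
rewrite /rentropy [in RHS](reindex_inj mI) /=; congr (- _); apply: eq_bigr => w _.
congr (ln _%:R); rewrite /fiber -[RHS](on_card_preimset (f := m)); last first.
  exact: onW_bij (injF_bij mI).
apply: eq_card => u; rewrite !inE !res_eq.
apply/forall_inP/forall_inP => h e; last by move=> /imsetP[x xS ->]; rewrite -!mE h.
by move=> eS; rewrite !mE h // imset_f.
Qed.
End RestrictionEntropy.

(** * Multigraphs *)

Definition mkvpair (V : finType) (e : {set V}) (e2 : #|e| == 2%N) : vpair V :=
  exist (fun f : {set V} => #|f| == 2%N) e e2.

Lemma card_vpair_sub (V : finType) (X : {set V}) :
  #|[pred e : vpair V | val e \subset X]| = 'C(#|X|, 2).
Proof.
rewrite -cards_draws -(card_imset _ val_inj); apply: eq_card => e.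
apply/imsetP/idP => [[f fX ->]|].
  by move: fX; rewrite !inE => ->; rewrite (valP f).
by rewrite !inE => /andP[eX e2]; exists (mkvpair e2).
Qed.

Lemma card_vpair (V : finType) : #|{: vpair V}| = 'C(#|V|, 2).
Proof.
rewrite -cardsT -card_vpair_sub; apply: eq_card => e.
by rewrite !inE finset.subsetT.
Qed.

Lemma exists_superset (V : finType) (s : nat) (A : {set V}) :
  (#|A| <= s <= #|V|)%N -> exists X : {set V}, A \subset X /\ #|X| = s.
Proof.
elim: s => [|s IH]; first by rewrite leqn0 => /andP[/eqP A0 _]; exists A.
case/andP; rewrite leq_eqVlt => /orP[/eqP As _|As sV]; first by exists A.
have [|X [AX Xs]] := IH; first by rewrite -ltnS As ltnW.
have /set0Pn[x xX] : ~: X != finset.set0.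
  by rewrite -card_gt0 cardsCs finset.setCK Xs subn_gt0.
exists (x |: X); split; first exact: (fintype.subset_trans AX (finset.subsetUr _ _)).
by move: xX; rewrite inE => xX; rewrite cardsU1 xX Xs.
Qed.

Lemma sq_graph_weight_le (V : finType) (s q : nat) (w : multigraph V) e :
  (2 <= s <= #|V|)%N -> is_sq_graph s q w -> (w e <= q)%N.
Proof.
move=> sV wsq; have [|X [eX Xs]] := @exists_superset _ s (val e).
  by rewrite (eqP (valP e)).
by apply: leq_trans (wsq X Xs); rewrite (bigD1 e) //= leq_addr.
Qed.

Lemma sq_graph_le (V : finType) (s q : nat) (w w' : multigraph V) :
  (forall e, (w e <= w' e)%N) -> is_sq_graph s q w' -> is_sq_graph s q w.
Proof. by move=> ww' w'sq X Xs; apply: leq_trans (w'sq X Xs); apply: leq_sum. Qed.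

(** An [s]-set contains exactly ['C(s, 2)] pairs; this is the origin of the shift from [q] to
    [Q]. *)
Lemma sq_graph_succ (V : finType) (s q : nat) (w : multigraph V) :
  is_sq_graph s q w -> is_sq_graph s (q + 'C(s, 2)) ([ffun e => (w e).+1] : multigraph V).
Proof.
move=> wsq X Xs; under eq_bigr do rewrite ffunE -addn1.
by rewrite big_split /= sum1_card card_vpair_sub Xs leq_add2r wsq.
Qed.

Lemma sq_graph_pred (V : finType) (s q : nat) (w : multigraph V) :
  (forall e, (0 < w e)%N) ->
  is_sq_graph s (q + 'C(s, 2)) w -> is_sq_graph s q ([ffun e => (w e).-1] : multigraph V).
Proof.
move=> w0 wsq X Xs; rewrite -(leq_add2r 'C(s, 2)); apply: leq_trans (wsq X Xs).
rewrite -Xs -card_vpair_sub -sum1_card -big_split /=.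
by apply: leq_sum => e _; rewrite ffunE addn1 prednK.
Qed.

Section Pullback.
Variables (V W : finType) (i : V -> W) (iI : injective i).

Lemma vmap_proof (e : vpair V) : #|i @: val e| == 2%N.
Proof. by rewrite card_imset // (valP e). Qed.

Definition vmap (e : vpair V) : vpair W := mkvpair (vmap_proof e).

Lemma vmap_inj : injective vmap.
Proof. by move=> e f /(congr1 val) /= /(imset_inj iI) /val_inj. Qed.

Lemma vmap_onto (e : vpair W) : val e \subset codom i -> exists f, e = vmap f.
Proof.
move=> ei; have E : i @: (i @^-1: val e) = val e.
  by apply/setP => x; apply/imsetP/idP => [[y]|xe]; [rewrite inE => ? ->|
    have /codomP[y xy] := fintype.subsetP ei x xe; exists y; rewrite ?inE -?xy].
have p : #|i @^-1: val e| == 2%N by rewrite -(card_imset _ iI) E (valP e).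
by exists (mkvpair p); apply: val_inj; rewrite /= E.
Qed.

Lemma sq_graph_pullback (s q : nat) (w : multigraph W) :
  is_sq_graph s q w -> is_sq_graph s q ([ffun e => w (vmap e)] : multigraph V).
Proof.
move=> wsq X Xs; have := wsq (i @: X); rewrite card_imset // => /(_ Xs).
apply: leq_trans; under eq_bigr do rewrite ffunE.
rewrite -(big_imset (A := [pred e : vpair V | val e \subset X]) w (in2W vmap_inj)) /=.
rewrite [X in (_ <= X)%N](bigID [in vmap @: [pred e : vpair V | val e \subset X]]) /=.
apply: leq_trans (leq_addr _ _); apply: eq_leq; apply: eq_bigl => e.
by apply/esym/andb_idl => /imsetP[f fX ->]; exact: imsetS.
Qed.
End Pullback.

(** * Extremal products and the number of graphs *)

Section Extremal.
Local Open Scope nat_scope.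

(** With [s <= n] the set of graphs is finite, so [fset_set] in [exPi_n] is faithful. *)
Lemma leq_exPi_n (n s q : nat) (w : multigraph 'I_n) : 2 <= s <= n ->
  is_sq_graph s q w -> weight_prod w <= exPi_n n s q.
Proof.
move=> /andP[s2 sn] wsq; have fin := sq_graphs_finite q s2 sn.
have wf : w \in fset_set (sq_graphs n s q) by rewrite in_fset_set //; apply: mem_set.
by rewrite /exPi_n (big_rem w wf) /= leq_maxl.
Qed.

Lemma exPi_n_attained (n s q : nat) : 2 <= s <= n -> 0 < exPi_n n s q ->
  exists2 w : multigraph 'I_n, is_sq_graph s q w & weight_prod w = exPi_n n s q.
Proof.
move=> /andP[s2 sn]; have fin := sq_graphs_finite q s2 sn.
rewrite /exPi_n big_seq.
apply: (big_ind (fun x => 0 < x -> 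
  exists2 w : multigraph 'I_n, is_sq_graph s q w & weight_prod w = x)) => //.
  by move=> x y hx hy; case: (leqP x y).
by move=> w; rewrite in_fset_set // => /set_mem wsq _; exists w.
Qed.

(** The all-one multigraph qualifies. Positivity keeps [ln] of the maximum away from its default
    value at 0. *)
Lemma exPi_n_gt0 (n s q : nat) : 2 <= s <= n -> 0 < exPi_n n s (q + 'C(s, 2)).
Proof.
move=> sn.
have w1 : is_sq_graph s (q + 'C(s, 2)) ([ffun=> 1] : multigraph 'I_n).
  have -> : [ffun=> 1] = [ffun e => ([ffun=> 0] e).+1] :> multigraph 'I_n.
    by apply/ffunP => e; rewrite !ffunE.
  by apply: sq_graph_succ => X _; rewrite big1 // => e _; rewrite ffunE.
apply: leq_trans (leq_exPi_n sn w1).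
by rewrite prodn_gt0 // => e; rewrite ffunE.
Qed.

Definition natw (V : finType) (q : nat) (w : {ffun vpair V -> 'I_q.+1}) : multigraph V :=
  [ffun e => nat_of_ord (w e)].

(** A finite model of F(n, s, q): once [2 <= s <= #|V|], no weight exceeds [q], so capping the
    weights loses nothing. *)
Definition sq_set (V : finType) (s q : nat) : {set {ffun vpair V -> 'I_q.+1}} :=
  [set w | `[< is_sq_graph s q (natw w) >]]%SET.

Lemma card_ord_ltn (m q : nat) : m <= q -> #|[pred a : 'I_q | a < m]| = m.
Proof. by move=> mq; rewrite -sum1_card (big_ord_narrow mq) sum1_card card_ord. Qed.

(** The top corner of the box, which takes the maximum of each [A e], is itself an (s, q)-graph.
    Adding 1 to its weights gives a competitor for [Q], whose weight at [e] is at least [#|A e|]. *)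
Lemma prod_card_le_exPi_n (k s q : nat) (A : vpair 'I_k -> {pred 'I_q.+1}) :
  2 <= s <= k ->
  (forall x : {ffun vpair 'I_k -> 'I_q.+1}, (forall e, x e \in A e) -> x \in sq_set 'I_k s q) ->
  \prod_e #|A e| <= exPi_n k s (q + 'C(s, 2)).
Proof.
move=> sk AB; have [A0|] := boolP [forall e, 0 < #|A e|]; last first.
  by rewrite negb_forall => /existsP[e]; rewrite lt0n negbK => /eqP e0; rewrite (bigD1 e) //= e0.
have P e : {a | a \in A e & forall b, b \in A e -> b <= a}.
  have /card_gt0P/sigW[a aA] := forallP A0 e.
  by case: (arg_maxnP (P := [in A e]) (fun a : 'I_q.+1 => a : nat) aA) => b bA bmax; exists b.
pose x : {ffun vpair 'I_k -> 'I_q.+1} := [ffun e => s2val (P e)].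
have xsq : x \in sq_set 'I_k s q by apply: AB => e; rewrite ffunE; case: (P e).
move: xsq; rewrite inE => /asboolP/sq_graph_succ/(leq_exPi_n sk); apply: leq_trans.
apply: leq_prod => e _; rewrite !ffunE; case: (P e) => a aA amax /=.
rewrite -[X in _ <= X](@card_ord_ltn _ q.+1) ?ltn_ord//.
by apply: subset_leq_card; apply/fintype.subsetP => b bA; rewrite inE ltnS amax.
Qed.

(** The graphs lying below an extremal graph lowered by 1 form a box with as many elements as the
    extremal product. *)
Lemma exPi_n_le_card (n s q : nat) : 2 <= s <= n ->
  exPi_n n s (q + 'C(s, 2)) <= #|sq_set 'I_n s q|.
Proof.
move=> sn; have [w wsq <-] := exPi_n_attained sn (exPi_n_gt0 q sn).
have [w0|] := boolP [forall e, 0 < w e]; last first.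
  rewrite negb_forall => /existsP[e]; rewrite lt0n negbK => /eqP e0.
  by rewrite /weight_prod (bigD1 e) //= e0.
have {}w0 e : 0 < w e by apply: (forallP w0).
have pw := sq_graph_pred w0 wsq.
apply: (@leq_trans #|family (fun e => [pred i : 'I_q.+1 | i < w e])|).
  rewrite card_family foldrE big_map big_enum /=; apply: leq_prod => e _.
  have := @sq_graph_weight_le _ s q _ e _ pw; rewrite card_ord ffunE => /(_ sn).
  by move=> wq; rewrite card_ord_ltn // -(prednK (w0 e)).
apply: subset_leq_card; apply/fintype.subsetP => x /familyP xw.
rewrite inE; apply/asboolP; apply: sq_graph_le pw => e; rewrite !ffunE.
by have := xw e; rewrite inE -{1}(prednK (w0 e)) ltnS.
Qed.

(** Multiply the bounds for the [n.+1] vertex deletions of an extremal graph: each pair survives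
    exactly [n.-1] of them. *)
Lemma exPi_n_mono (n s q : nat) : 2 <= s <= n ->
  exPi_n n.+1 s q ^ n.-1 <= exPi_n n s q ^ n.+1.
Proof.
move=> sn; have [->|] := posnP (exPi_n n.+1 s q).
  by rewrite exp0n //; lia.
have sn1 : 2 <= s <= n.+1 by lia.
move=> /(exPi_n_attained sn1) [w wsq <-].
have -> : exPi_n n s q ^ n.+1 = \prod_(v : 'I_n.+1) exPi_n n s q by rewrite prod_nat_const card_ord.
apply: (@leq_trans (\prod_(v : 'I_n.+1)
    weight_prod [ffun e => w (vmap (@lift_inj _ v) e)])); last first.
  by apply: leq_prod => v _; apply: leq_exPi_n => //; apply: sq_graph_pullback.
have lift_prod (v : 'I_n.+1) :
  weight_prod ([ffun e => w (vmap (@lift_inj _ v) e)] : multigraph 'I_n) =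
    \prod_(e : vpair 'I_n.+1 | v \notin val e) w e.
  rewrite /weight_prod; under eq_bigr do rewrite ffunE.
  rewrite -(big_imset (A := predT) w (in2W (@vmap_inj _ _ _ (@lift_inj _ v)))) /=.
  apply: eq_bigl => e; apply/imsetP/idP => [[f _ ->]|ve].
    by apply/negP => /imsetP[x _ /eqP]; rewrite (negbTE (neq_lift _ _)).
  have [|f ->] := @vmap_onto _ _ _ (@lift_inj _ v) e; last by exists f.
  apply/fintype.subsetP => x xe; have [j ->|xv] := unliftP v x; first exact: codom_f.
  by rewrite -xv xe in ve.
rewrite (eq_bigr _ (fun v _ => lift_prod v)) (exchange_big_dep predT) //=.
rewrite (big_morph (expn^~ n.-1) (id1 := 1) (op1 := muln)) ?exp1n//; last first.
  by move=> x y; rewrite expnMn.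
apply: leq_prod => e _; rewrite prod_nat_const.
rewrite (_ : #|_| = #|~: val e|); last by apply: eq_card => v; rewrite !inE.
by have := cardsC (val e); rewrite (eqP (valP e)) card_ord add2n => -[/(congr1 predn) /= ->].
Qed.

End Extremal.

(** * Exchangeable submodular functions of pairs *)

(** List [T] as [A], then [U :\: A], then the complement of [U], do the same for [A'] and [U'], and
    match equal positions. *)
Lemma exists_inj_nested (T : finType) (A U A' U' : {set T}) :
  A \subset U -> A' \subset U' -> #|A| = #|A'| -> #|U| = #|U'| ->
  exists2 p : T -> T, injective p & p @: A = A' /\ p @: U = U'.
Proof.
pose l (A U : {set T}) := enum A ++ enum (U :\: A) ++ enum (~: U).
have memA (A1 U1 : {set T}) x : (index x (l A1 U1) < #|A1|)%N = (x \in A1).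
  rewrite /l index_cat mem_enum; case: ifPn => xA.
    by rewrite cardE index_mem mem_enum.
  by rewrite -cardE ltnNge leq_addr.
have memU (A1 U1 : {set T}) x : A1 \subset U1 -> (index x (l A1 U1) < #|U1|)%N = (x \in U1).
  move=> AU; have e : #|U1| = size (enum A1 ++ enum (U1 :\: A1)).
    by rewrite size_cat -!cardE -(cardsID A1 U1) (finset.setIidPr AU).
  have m : (x \in enum A1 ++ enum (U1 :\: A1)) = (x \in U1).
    rewrite mem_cat !mem_enum !inE; case: (boolP (x \in A1)) => //= xA.
    by rewrite (fintype.subsetP AU).
  rewrite /l catA index_cat m; case: ifPn => xU; first by rewrite e index_mem m xU.
  by rewrite e ltnNge leq_addr.
have lu (A1 U1 : {set T}) : A1 \subset U1 -> uniq (l A1 U1).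
  move=> AU; rewrite /l !cat_uniq !enum_uniq /= andbT; apply/andP; split.
    apply/hasPn => x; rewrite mem_cat !mem_enum !inE => /orP[/andP[]//|].
    by apply: contra => /(fintype.subsetP AU).
  by apply/hasPn => x; rewrite !mem_enum !inE => /negbTE ->; rewrite andbF.
have lT (A1 U1 : {set T}) x : x \in l A1 U1.
  by rewrite !mem_cat !mem_enum !inE; case: (x \in A1); case: (x \in U1).
have ls (A1 U1 : {set T}) : A1 \subset U1 -> size (l A1 U1) = #|T|.
  by move=> AU; rewrite -(card_uniqP (lu _ _ AU)); apply: eq_card => x; rewrite lT.
move=> AU AU' cA cU; pose p x := nth x (l A' U') (index x (l A U)).
have idx x : (index x (l A U) < size (l A' U'))%N by rewrite ls // -(ls _ _ AU) index_mem.
have pidx x : index (p x) (l A' U') = index x (l A U) by rewrite index_uniq ?lu.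
have pI : injective p.
  move=> x y /(congr1 (index^~ (l A' U'))); rewrite !pidx => e.
  by rewrite -(nth_index x (lT A U x)) e nth_index.
exists p => //; split; apply/eqP; rewrite eqEcard card_imset // ?cA ?cU leqnn andbT;
  apply/fintype.subsetP => _ /imsetP[x xA ->].
  by rewrite -(memA _ U') pidx -cA memA.
by rewrite -(memU A') // pidx -cU memU.
Qed.

Section Exchangeable.
Variables (R : realType) (n : nat) (f : {set vpair 'I_n} -> R) (C : R).
Hypothesis fS : forall A B X : {set vpair 'I_n}, A \subset B ->
  f (B :|: X) - f B <= f (A :|: X) - f A.
Hypothesis fle : forall A B : {set vpair 'I_n}, A \subset B -> f A <= f B.
Hypothesis fC : forall A e, f (e |: A) - f A <= C.
Hypothesis f_inv : forall (i : 'I_n -> 'I_n) (iI : injective i)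
  (A : {set vpair 'I_n}), f (vmap iI @: A) = f A.

Definition clique (U : {set 'I_n}) : {set vpair 'I_n} := [set e : vpair 'I_n | val e \subset U].

Definition touching (T : {set 'I_n}) : {set vpair 'I_n} :=
  [set e : vpair 'I_n | ~~ [disjoint val e & T]].

Definition segment m : {set 'I_n} := [set i : 'I_n | (i < m)%N].

Lemma card_segment m : (m <= n)%N -> #|segment m| = m.
Proof. by move=> mn; rewrite -[RHS](card_ord_ltn mn); apply: eq_card => i; rewrite !inE. Qed.

Lemma card_clique U : #|clique U| = 'C(#|U|, 2).
Proof. by rewrite -card_vpair_sub; apply: eq_card => e; rewrite !inE. Qed.

Lemma segmentS m m' : (m <= m')%N -> segment m \subset segment m'.
Proof. by move=> mm; apply/fintype.subsetP => i; rewrite !inE => /leq_trans; apply. Qed.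

(* The conditional entropy of one pair given all other pairs inside a set of
   [m] vertices. *)
Definition gain m : R := f (clique (segment m)) -
  f (clique (segment m) :\: [set e : vpair 'I_n | val e == segment 2]).

(** A permutation of the vertices carries [val e] to [segment 2] and [U] to a segment, and [f] is
    invariant under it. *)
Lemma gainE (U : {set 'I_n}) (e : vpair 'I_n) : val e \subset U ->
  f (clique U) - f (clique U :\ e) = gain #|U|.
Proof.
move=> eU; have Un : (#|U| <= n)%N by rewrite -[X in (_ <= X)%N](card_ord n) max_card.
have U2 : (2 <= #|U|)%N by rewrite -(eqP (valP e)) subset_leq_card.
have [||p pI [pe pU]] := exists_inj_nested eU (segmentS U2).
- by rewrite (eqP (valP e)) card_segment // (leq_trans U2).
- by rewrite card_segment.
have vE x : val (vmap pI x) = p @: val x by [].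
have cE : vmap pI @: clique U = clique (segment #|U|).
  apply/setP => x; apply/imsetP/idP => [[y]|].
    by rewrite !inE => yU ->; rewrite vE -pU imsetS.
  rewrite inE => xU; have [|y xy] := @vmap_onto _ _ p pI x.
    apply/fintype.subsetP => z zx; have := fintype.subsetP xU _ zx.
    by rewrite -pU => /imsetP[u _ ->]; apply: codom_f.
  exists y => //; rewrite inE; move: xU; rewrite xy vE -pU.
  move=> yU; apply/fintype.subsetP => u uy.
  by have := fintype.subsetP yU _ (imset_f p uy); rewrite mem_imset.
rewrite -(f_inv pI) -(f_inv pI (_ :\ _)) /gain cE; congr (_ - f _).
rewrite -cE; apply/setP => x; rewrite !inE; apply/imsetP/andP => [[y]|[xe /imsetP[y yU xy]]].
  rewrite !inE => /andP[ye yU] ->; split; last by rewrite imset_f // inE.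
  by apply: contra ye => /eqP; rewrite -pe -vE => /val_inj /vmap_inj ->.
exists y => //; rewrite !inE; move: yU; rewrite inE => ->; rewrite andbT.
by apply: contra xe => /eqP ye; rewrite xy vE ye pe.
Qed.

Lemma clique_pair (e : vpair 'I_n) (U : {set 'I_n}) : val e \subset U ->
  clique U :\ e :|: [set e] = clique U.
Proof. by move=> eU; rewrite finset.setUC finset.setD1K // inE. Qed.

Lemma cliqueS (U U' : {set 'I_n}) : U \subset U' -> clique U \subset clique U'.
Proof.
by move=> UU; apply/fintype.subsetP => e; rewrite !inE => /fintype.subset_trans; apply.
Qed.

Lemma exists_pair m : (2 <= m <= n)%N -> exists e : vpair 'I_n, val e \subset segment m.
Proof.
case/andP=> m2 mn; have c : #|segment 2| == 2%N by rewrite card_segment // (leq_trans m2).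
by exists (mkvpair c); apply: segmentS.
Qed.

(** The same pair is conditioned on more pairs, so submodularity applies. *)
Lemma gain_anti m m' : (2 <= m <= m')%N -> (m' <= n)%N -> gain m' <= gain m.
Proof.
move=> /andP[m2 mm] mn; have mn' := leq_trans mm mn.
have [|e em] := @exists_pair m; first by rewrite m2.
have em' := fintype.subset_trans em (segmentS mm).
have := gainE em; have := gainE em'; rewrite !card_segment // => <- <-.
rewrite -{1}(clique_pair em') -{1}(clique_pair em); apply: fS.
by apply: setSD; apply/cliqueS/segmentS.
Qed.

Lemma gain_ge0 m : (2 <= m <= n)%N -> 0 <= gain m.
Proof.
move=> mn; have [e em] := exists_pair mn; case/andP: mn => _ mn.
by have := gainE em; rewrite card_segment // => <-; rewrite subr_ge0 fle // subD1set.
Qed.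

Lemma gain_le m : (2 <= m <= n)%N -> gain m <= C.
Proof.
move=> mn; have [e em] := exists_pair mn; case/andP: mn => _ mn.
have := gainE em; rewrite card_segment // => <-.
by rewrite -{1}(clique_pair em) finset.setUC.
Qed.

(** Every pair inside [T :|: val e] other than [e] meets [T], so at least as much is conditioned on
    here as in [gain (#|T| + 2)]. *)
Lemma touching_gain (T U : {set 'I_n}) (e : vpair 'I_n) :
  T \subset U -> e \in clique (U :\: T) ->
  f (e |: (clique U :&: touching T)) - f (clique U :&: touching T) <= gain (#|T| + 2).
Proof.
rewrite inE => TU /subsetDP[eU dT].
have <- : #|T :|: val e| = (#|T| + 2)%N.
  by rewrite cardsU (eqP (valP e)) finset.setIC disjoint_setI0 // cards0 subn0.
rewrite -(@gainE (T :|: val e) e) ?finset.subsetUr//.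
rewrite -{1}(clique_pair (finset.subsetUr T (val e))).
rewrite [e |: _]finset.setUC; apply: fS; apply/fintype.subsetP => x.
rewrite !inE => /andP[xe xTe]; rewrite (fintype.subset_trans xTe) ?finset.subUset ?TU//=.
apply: contra xe => xT; apply/eqP/val_inj/eqP.
rewrite eqEcard (eqP (valP x)) (eqP (valP e)) leqnn andbT.
apply/fintype.subsetP => z zx; have := fintype.subsetP xTe z zx.
by rewrite inE (disjointFr xT zx).
Qed.

Lemma clique_split (T U : {set 'I_n}) :
  clique U = (clique U :&: touching T) :|: clique (U :\: T).
Proof.
apply/setP => e; rewrite !inE subsetD; case: (val e \subset U) => //=.
by rewrite orbC orbN.
Qed.

Lemma clique_touching_disjoint (T U : {set 'I_n}) :
  [disjoint clique (U :\: T) & clique U :&: touching T].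
Proof.
apply/pred0P => e; apply/negP; rewrite /= !inE subsetD.
by move=> /andP[/andP[_ ->]]; rewrite andbF.
Qed.

(** Each pair inside [U :\: T] contributes at least its increment given all other pairs of [U],
    which is [gain #|U|]. *)
Lemma clique_gain_ge (T U : {set 'I_n}) : T \subset U ->
  'C(#|U| - #|T|, 2)%:R * gain #|U| <=
  f (clique U) - f (clique U :&: touching T).
Proof.
move=> TU; rewrite {1}(clique_split T U).
apply: le_trans (submod_sum_le fS (clique_touching_disjoint T U)).
rewrite -clique_split (eq_bigr (fun=> gain #|U|)).
  by rewrite sumr_const card_clique cardsDS // mulr_natl.
by move=> e; rewrite inE => /subsetDP[eU _]; rewrite gainE.
Qed.

Lemma card_touching (T : {set 'I_n}) : (#|touching T| <= #|T| * n)%N.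
Proof.
have -> : (#|T| * n = #|finset.setX T [set: 'I_n]|)%N by rewrite cardsX cardsT card_ord.
rewrite -(card_imset _ val_inj).
apply: leq_trans (leq_imset_card (fun xy => [set xy.1; xy.2]) _).
apply: subset_leq_card; apply/fintype.subsetP => _ /imsetP[e eT ->].
move: eT; rewrite inE -setI_eq0 => /set0Pn[x]; rewrite inE => /andP[xe xT].
have : #|val e :\ x| == 1%N by have := valP e; rewrite (cardsD1 x) xe.
case/cards1P => y yE; apply/imsetP; exists (x, y); first by rewrite !inE xT.
by rewrite /= -yE finset.setD1K.
Qed.

(** Reveal first the at most [t * n] pairs meeting [T], at cost at most [C] each. By [touching_gain]
    every remaining pair then costs at most [gain (t + 2)]. *)
Lemma total_le t : (t + 2 <= n)%N ->
  f finset.setT - f finset.set0 <= (t * n)%:R * C + 'C(n, 2)%:R * gain (t + 2).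
Proof.
move=> tn; set T := segment t.
have cT : #|T| = t by rewrite card_segment //; lia.
have C0 : 0 <= C by apply: le_trans (gain_le (m := t + 2) _); [apply: gain_ge0|]; rewrite ?tn; lia.
pose U : {set 'I_n} := finset.setT.
have KU : clique U = finset.setT by apply/setP => e; rewrite !inE finset.subsetT.
have -> : f finset.setT - f finset.set0 =
    (f (touching T) - f finset.set0) + (f finset.setT - f (touching T)) by ring.
apply: lerD.
  rewrite -{1}(finset.set0U (touching T)); apply: le_trans (submod_sum_ge fS _ _) _.
  apply: (@le_trans _ _ (\sum_(e in touching T) C)); first exact: ler_sum.
  by rewrite sumr_const -[X in X <= _]mulr_natl ler_wpM2r // ler_nat -cT card_touching.
have E := clique_split T U; rewrite KU finset.setTI in E.
rewrite {1}E; apply: le_trans (submod_sum_ge fS _ _) _.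
apply: (@le_trans _ _ (\sum_(e in clique (U :\: T)) gain (t + 2))).
  apply: ler_sum => e eU; have := touching_gain (finset.subsetT T) eU.
  by rewrite KU finset.setTI cT.
rewrite sumr_const -[X in X <= _]mulr_natl ler_wpM2r //; first by rewrite gain_ge0 ?tn; lia.
by rewrite ler_nat card_clique leq_bin2l // -[X in (_ <= X)%N](card_ord n) max_card.
Qed.

(** Pigeonhole: the [M] successive drops of [gain] along steps of length [k] telescope to at most
    [C], since [gain] stays between 0 and [C]. *)
Lemma exists_small_drop (k M : nat) : (2 <= k)%N -> (0 < M)%N -> (M * k + 2 <= n)%N ->
  exists2 j, (j < M)%N & gain (j * k + 2) - gain (j * k + k) <= C / M%:R.
Proof.
move=> k2 M0 Mn; pose y j := gain (j * k + 2).
suff [j jM yj] : exists2 j, (j < M)%N & y j - y j.+1 <= C / M%:R.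
  (* As [j * k + k] is at most [j.+1 * k + 2], the drop wanted is at most [y j - y j.+1]. *)
  exists j => //; apply: le_trans yj; rewrite lerD2l lerN2.
  have jk : (j.+1 * k <= M * k)%N by rewrite leq_mul2r jM orbT.
  by apply: gain_anti; move: jk; rewrite mulSn; lia.
apply: contrapT => H.
have {}H j : (j < M)%N -> C / M%:R < y j - y j.+1.
  by move=> jM; rewrite ltNge; apply/negP => yj; apply: H; exists j.
have : \sum_(0 <= j < M) (C / M%:R) < \sum_(0 <= j < M) (y j - y j.+1).
  by apply: ltr_sum_nat => // j /andP[_ jM]; apply: H.
rewrite sumr_const_nat subn0 -[X in X < _]mulr_natr divfK ?pnatr_eq0 -?lt0n//.
under eq_bigr do rewrite -opprB.
rewrite sumrN telescope_sumr // opprB ltNge; apply/negP; rewrite negbK.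
rewrite lerBlDr (le_trans (gain_le _)) ?lerDl ?gain_ge0//; lia.
Qed.
End Exchangeable.

(** * The block estimate *)

Section SqEntropy.
Variables (R : realType) (n s q : nat).
Let B := sq_set 'I_n s q.
Let f : {set vpair 'I_n} -> R := rentropy R B.
Let N : R := #|B|%:R.
Let L : R := ln q.+1%:R.

Lemma sq_set_pullback (k : nat) (i : 'I_k -> 'I_n) (iI : injective i) x :
  x \in B -> [ffun e => x (vmap iI e)] \in sq_set 'I_k s q.
Proof.
rewrite !inE => /asboolP xsq; apply/asboolP.
rewrite (_ : natw _ = [ffun e => natw x (vmap iI e)]); first exact: sq_graph_pullback.
by apply/ffunP => e; rewrite !ffunE.
Qed.

Let fS := @rentropy_submod R _ _ B.
Let fle := le_rentropy R B.

Lemma sq_rentropyU1_le (A : {set vpair 'I_n}) e : f (e |: A) - f A <= N * L.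
Proof. by rewrite /L -[in ln _](card_ord q.+1); apply: rentropyU1_le. Qed.

Lemma sq_rentropy_vmap (i : 'I_n -> 'I_n) (iI : injective i) (A : {set vpair 'I_n}) :
  f (vmap iI @: A) = f A.
Proof.
apply: rentropy_imset; first exact: vmap_inj.
by move=> w; apply: sq_set_pullback.
Qed.

Lemma sq_set_card_gt0 : (0 < #|B|)%N.
Proof.
apply/card_gt0P; exists [ffun=> ord0]; rewrite inE; apply/asboolP => X _.
by rewrite big1 // => e _; rewrite !ffunE.
Qed.

Section Block.
Variables (k t : nat) (d : R).
Hypotheses (sk : (2 <= s <= k)%N) (tkn : (t + k <= n)%N) (d0 : 0 < d) (dq : d * q.+1%:R <= 1).
Let i0 (j : 'I_k) : 'I_n := widen_ord tkn (rshift t j).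
Let i0I : injective i0.
Proof. by move=> j j' /(congr1 val) /= /addnI /val_inj. Qed.
Let kap := 'C(k, 2).
Let kapE : kap = #|{: vpair 'I_k}|.
Proof. by rewrite card_vpair card_ord. Qed.
(** The block consists of the [k] vertices following the first [t]. Among the pairs on these [t + k]
    vertices, [Z] records those meeting the first [t] and [X] those inside the block. *)
Let D := clique (segment n (t + k)) :&: touching (segment n t).
Let Z := res (B := B) D.
Let X (w : {w | w \in B}) : {ffun vpair 'I_k -> 'I_q.+1} := [ffun e => val w (vmap i0I e)].

Let block_clique :
  clique (segment n (t + k) :\: segment n t) = [set vmap i0I e | e : vpair 'I_k].
Proof.
apply/setP => e; apply/idP/imsetP => [|[e' _ ->]]; last first.
  rewrite inE; apply/fintype.subsetP => _ /imsetP[j _ ->].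
  by rewrite !inE /= -leqNgt leq_addr ltn_add2l ltn_ord.
rewrite inE => eK; have [|e' ->] := @vmap_onto _ _ _ i0I e; last by exists e'.
apply/fintype.subsetP => x /(fintype.subsetP eK); rewrite !inE -leqNgt => /andP[tx xtk].
have xk : (x - t < k)%N by lia.
apply/codomP; exists (Ordinal xk); apply: val_inj => /=; lia.
Qed.

Let TU : segment n t \subset segment n (t + k).
Proof. by apply: segmentS; rewrite leq_addr. Qed.

Let fiber1 e : fiber (joint Z (fun w => X w e)) =1 fiber (res (B := B) (vmap i0I e |: D)).
Proof.
move=> w; rewrite -fiber_res1; move: w; apply: eq_fiber => u v.
by rewrite !xpair_eqE !ffunE.
Qed.

Let fiberX : fiber (joint Z X) =1 fiber (res (B := B) (clique (segment n (t + k)))).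
Proof.
move=> w; rewrite (clique_split (segment n t)) -/D -fiber_resU; move: w; apply: eq_fiber => u v.
rewrite !xpair_eqE !res_eq; congr (_ && _); rewrite block_clique.
apply/eqP/forall_inP => [/ffunP uv _ /imsetP[e _ ->]|uv].
  by have := uv e; rewrite !ffunE => ->.
by apply/ffunP => e; rewrite !ffunE; apply/eqP/uv/imset_f.
Qed.

(** Given [Z], [marg] adds the entropies of the single pairs of the block and [tot] is their joint
    entropy, both scaled by [N]; [marg - tot] measures their dependence. *)
Let marg := \sum_e (f (vmap i0I e |: D) - f D).
Let tot := f (clique (segment n (t + k))) - f D.
Let missing w := \sum_(x | ~~ occurs Z X (Z w) x) \prod_e cond R Z (fun u => X u e) (Z w) (x e).

Let missing_ge0 w : 0 <= missing w.
Proof. by apply: sumr_ge0 => x _; apply: prodr_ge0 => e _; apply: cond_ge0. Qed.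

Let missing_sum_le : \sum_w missing w <= marg - tot.
Proof.
have := missing_mass_le R Z X; rewrite sumrB exchange_big /=.
under [X in _ <= X - _ -> _]eq_bigr => e _ do
  (under eq_bigr => w _ do rewrite fiber1; rewrite -(rentropyB R)).
by under [X in _ <= _ - X -> _]eq_bigr => w _ do rewrite fiberX; rewrite -(rentropyB R).
Qed.

Let marg_le : marg <= kap%:R * gain f (t + 2).
Proof.
rewrite /marg kapE mulr_natl -sumr_const; apply: ler_sum => e _.
have := touching_gain fS sq_rentropy_vmap TU (e := vmap i0I e).
rewrite block_clique imset_f // => /(_ isT).
by rewrite card_segment //; apply: leq_trans tkn; apply: leq_addr.
Qed.

Let tot_ge : kap%:R * gain f (t + k) <= tot.
Proof.
have := clique_gain_ge fS sq_rentropy_vmap TU.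
by rewrite !card_segment ?addKn //; apply: leq_trans tkn; apply: leq_addr.
Qed.

(** Otherwise the [q.+1] conditional probabilities would sum to less than [d * q.+1%:R <= 1]. *)
Let likely_gt0 e w : (0 < likely Z (fun u => X u e) d (Z w))%N.
Proof.
rewrite lt0n; apply/negP => /eqP/card0_eq H.
have : \sum_x cond R Z (fun u => X u e) (Z w) x < \sum_(x : 'I_q.+1) d.
  apply: ltr_sum => [|x _]; first by apply/hasP; exists ord0; rewrite ?mem_index_enum.
  by have := H x; rewrite inE leNgt => /negbFE.
by rewrite sum_cond sumr_const card_ord -mulr_natr ltNge dq.
Qed.

(* If every combination of likely values occurs, the sets of likely values form
   a product inside [F(k, s, q)]; otherwise a combination of mass at least
   [d ^+ kap] is missing. *)
Let sum_likely_le w : \sum_e ln (likely Z (fun u => X u e) d (Z w))%:R <=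
  ln (exPi_n k s (q + 'C(s, 2)))%:R + kap%:R * L / d ^+ kap * missing w.
Proof.
pose A e := [pred x | d <= cond R Z (fun u => X u e) (Z w) x].
have L0 : 0 <= L by rewrite ln_ge0 // ler1n.
have ex0 : 0 <= ln (exPi_n k s (q + 'C(s, 2)))%:R :> R.
  by rewrite ln_ge0 // ler1n exPi_n_gt0.
have [AB|] := pselect (forall x : {ffun vpair 'I_k -> 'I_q.+1},
    (forall e, x e \in A e) -> occurs Z X (Z w) x).
  rewrite -ln_prod => [|e _]; last by rewrite ltr0n likely_gt0.
  rewrite -natr_prod; apply: (@le_trans _ _ (ln (exPi_n k s (q + 'C(s, 2)))%:R)).
    rewrite ler_ln ?posrE ?ltr0n ?exPi_n_gt0 ?prodn_gt0// ler_nat.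
    apply: (@prod_card_le_exPi_n k s q A) => // x /AB /existsP[u /andP[_ /eqP <-]].
    by rewrite /X; apply: sq_set_pullback; apply: valP.
  by rewrite lerDl mulr_ge0 // mulr_ge0 ?invr_ge0 ?exprn_ge0 ?mulr_ge0// ltW.
move=> /existsNP[x /not_implyP[xA /negP xocc]].
have mw : d ^+ kap <= missing w.
  rewrite /missing (bigD1 x) //= -[X in X <= _]addr0 lerD //; last first.
    by apply: sumr_ge0 => y _; apply: prodr_ge0 => e _; apply: cond_ge0.
  rewrite kapE -prodr_const; apply: ler_prod => e _.
  by rewrite (ltW d0) /=; have := xA e; rewrite inE.
apply: (@le_trans _ _ (kap%:R * L)).
  rewrite kapE mulr_natl -sumr_const; apply: ler_sum => e _.
  rewrite ler_ln ?posrE ?ltr0n ?likely_gt0// ler_nat -[X in (_ <= X)%N](card_ord q.+1).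
  exact: max_card.
rewrite ler_wpDl // -[X in X <= _]mulr1 -[X in _ <= X]mulrA ler_wpM2l ?mulr_ge0//.
by rewrite mulrC ler_pdivlMr ?exprn_gt0// mul1r.
Qed.

(** The left side is at most [tot], hence at most [marg], which is bounded through the likely
    values. The missing mass this introduces is at most [marg - tot], hence at most [kap] times the
    drop of [gain]. *)
Lemma block_gain_le : kap%:R * gain f (t + k) <=
  N * ln (exPi_n k s (q + 'C(s, 2)))%:R +
  kap%:R * L / d ^+ kap * (kap%:R * (gain f (t + 2) - gain f (t + k))) +
  kap%:R * (N * (q.+1%:R * (d + 2 * Num.sqrt d))).
Proof.
have L0 : 0 <= L by rewrite ln_ge0 // ler1n.
have m0 : 0 <= \sum_w missing w by apply: sumr_ge0 => w _; apply: missing_ge0.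
have mle := missing_sum_le; have tg := tot_ge; have ml := marg_le.
apply: (@le_trans _ _ marg); first lra.
have : marg <= \sum_w \sum_e ln (likely Z (fun u => X u e) d (Z w))%:R +
    kap%:R * (N * (q.+1%:R * (d + 2 * Num.sqrt d))).
  rewrite /marg [X in _ <= X + _]exchange_big /= kapE mulr_natl -sumr_const -big_split /=.
  apply: ler_sum => e _.
  have := ln_fiber_le_likely Z (fun u => X u e) d0.
  rewrite big_split /= sumr_const card_ord card_sig -[X in _ + X]mulr_natl.
  by under eq_bigr => w _ do rewrite fiber1; rewrite -(rentropyB R).
move=> /le_trans; apply; rewrite lerD2r.
apply: (le_trans (ler_sum _ (fun w _ => sum_likely_le w))).
rewrite big_split /= sumr_const card_sig -[X in X + _]mulr_natl -mulr_sumr lerD2l.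
rewrite ler_wpM2l //; last lra.
by rewrite divr_ge0 ?mulr_ge0 // exprn_ge0 // ltW.
Qed.
End Block.

Lemma ln_card_sq_set_le (k M : nat) (d : R) :
  (2 <= s <= k)%N -> (0 < M)%N -> (M * k + 2 <= n)%N -> 0 < d -> d * q.+1%:R <= 1 ->
  ln #|B|%:R <= (M * k * n)%:R * L + 'C(n, 2)%:R *
    (ln (exPi_n k s (q + 'C(s, 2)))%:R / 'C(k, 2)%:R +
     ('C(k, 2)%:R * L ^+ 2 / d ^+ 'C(k, 2) / M%:R + q.+1%:R * (d + 2 * Num.sqrt d))).
Proof.
move=> sk M0 Mn d0 dq.
have k2 : (2 <= k)%N by case/andP: sk; apply: leq_trans.
have N0 : 0 < N by rewrite ltr0n sq_set_card_gt0.
have kap0 : (0 : R) < 'C(k, 2)%:R by rewrite ltr0n bin_gt0.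
have L0 : 0 <= L by rewrite ln_ge0 // ler1n.
have [j jM drop] := exists_small_drop fS fle sq_rentropyU1_le sq_rentropy_vmap k2 M0 Mn.
have jkM : (j * k + k <= M * k)%N by rewrite addnC -mulSn leq_mul2r jM orbT.
have jkn : (j * k + k <= n)%N by lia.
have blk := block_gain_le sk jkn d0 dq.
(* With [t = j * k + k - 2], the gain in [total_le] is the one that [blk] bounds. *)
have tot := @total_le R n f (N * L) fS fle sq_rentropyU1_le sq_rentropy_vmap (j * k + k - 2).
rewrite subnK in tot; last lia.
have {}tot := tot jkn.
rewrite /f rentropyT rentropy0 sub0r opprK -/N -/f in tot.
rewrite -(ler_pM2l N0); apply: (le_trans tot).
rewrite [X in _ <= X]mulrDr lerD //.
  by rewrite [X in X <= _]mulrCA ler_wpM2l ?(ltW N0)// ler_wpM2r // ler_nat leq_mul2r; lia.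
rewrite [X in _ <= X]mulrCA ler_wpM2l // -(ler_pM2l kap0); apply: (le_trans blk).
set a := ln _; set e := q.+1%:R * _; set kap := 'C(k, 2)%:R; set p := d ^+ _.
have p0 : 0 < p by rewrite exprn_gt0.
have -> : kap * (N * (a / kap + (kap * L ^+ 2 / p / M%:R + e))) =
  N * a + kap * L / p * (kap * (N * L / M%:R)) + kap * (N * e).
  by field; rewrite pnatr_eq0 -lt0n M0 !gt_eqF.
rewrite lerD2r lerD2l ler_wpM2l ?divr_ge0 ?mulr_ge0 ?(ltW p0) ?(ltW kap0)//.
by rewrite ler_wpM2l // ltW.
Qed.
End SqEntropy.

Local Open Scope classical_set_scope.

(** * Counting *)

Section Counting.
Variables (R : realType) (s q : nat).
Hypothesis s2 : (2 <= s)%N.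

Lemma natw_inj (V : finType) : injective (@natw V q).
Proof.
move=> x y /ffunP xy; apply/ffunP => e; apply: val_inj.
by have := xy e; rewrite !ffunE.
Qed.

Lemma counting_sq_graphs n : (s <= n)%N ->
  counting (sq_graphs n s q) = (#|sq_set 'I_n s q|%:R)%:E :> \bar R.
Proof.
move=> sn; have fin := sq_graphs_finite q s2 sn.
rewrite /counting asboolT //; congr (_%:R%:E).
rewrite cardE -(size_map (@natw _ q)); apply: perm_size; apply: uniq_perm.
- exact: finmap.fset_uniq.
- by rewrite map_inj_uniq ?enum_uniq //; apply: natw_inj.
move=> w; apply/idP/mapP => [|[x]]; last first.
  by rewrite mem_enum !inE => /asboolP xsq ->; rewrite in_fset_set //; apply: mem_set.
rewrite in_fset_set // => /set_mem wsq.
have wq e : (w e < q.+1)%N by rewrite ltnS (@sq_graph_weight_le _ s q) ?s2 ?card_ord.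
have wE : w = natw [ffun e => Ordinal (wq e)] by apply/ffunP => e; rewrite !ffunE.
by exists [ffun e => Ordinal (wq e)] => //; rewrite mem_enum inE -wE; apply/asboolP.
Qed.

(** There is no [s]-set, so the constraint is vacuous and a pair may take any weight. *)
Lemma counting_sq_graphs_small n : (2 <= n < s)%N ->
  counting (sq_graphs n s q) = +oo%E :> \bar R.
Proof.
move=> /andP[n2 ns]; rewrite /counting asboolF // => fin.
have [|e _] := @exists_pair n 2; first by rewrite n2.
apply: infinite_nat; apply: sub_finite_set (finite_image (fun w : multigraph 'I_n => w e) fin).
move=> m _ /=; exists [ffun=> m]; last by rewrite ffunE.
move=> X Xs; have := max_card [in X]; rewrite card_ord Xs; lia.
Qed.

Let Q := (q + 'C(s, 2))%N.
Let lex n : R := ln (exPi_n n s Q)%:R.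
Let ell n : R := lex n / 'C(n, 2)%:R.

Let lex_ge0 n : (s <= n)%N -> 0 <= lex n.
Proof. by move=> sn; rewrite /lex ln_ge0 // ler1n exPi_n_gt0 // s2. Qed.

Let ell_anti n : (s <= n)%N -> ell n.+1 <= ell n.
Proof.
move=> sn; have n2 : (2 <= n)%N by apply: leq_trans sn.
have bn : 2 * 'C(n, 2)%:R = (n.-1)%:R * n%:R :> R.
  by rewrite -!natrM mul_bin_left bin1 subn1.
have bn1 : 2 * 'C(n.+1, 2)%:R = n%:R * n.+1%:R :> R.
  by rewrite -!natrM mul_bin_left bin1 subn1.
have h : (n.-1)%:R * lex n.+1 <= n.+1%:R * lex n.
  rewrite !mulr_natl -!lnXn ?ltr0n ?exPi_n_gt0 ?s2 ?(leqW sn)// -!natrX.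
  by rewrite ler_ln ?posrE ?ltr0n ?expn_gt0 ?exPi_n_gt0 ?s2 ?(leqW sn)// ler_nat exPi_n_mono ?s2.
have c0 : (0 : R) < 'C(n, 2)%:R by rewrite ltr0n bin_gt0.
have c1 : (0 : R) < 'C(n.+1, 2)%:R by rewrite ltr0n bin_gt0 leqW.
rewrite /ell ler_pdivrMr // mulrAC ler_pdivlMr //.
have e0 : 2 * (lex n.+1 * 'C(n, 2)%:R) = n%:R * ((n.-1)%:R * lex n.+1).
  by rewrite mulrCA bn; ring.
have e1 : 2 * (lex n * 'C(n.+1, 2)%:R) = n%:R * (n.+1%:R * lex n).
  by rewrite mulrCA bn1; ring.
by rewrite -(ler_pM2l (_ : 0 < 2)) // e0 e1 ler_wpM2l.
Qed.

(** The logarithm of the limit ex_Pi(s, Q); see [exPiE]. *)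
Let lam := limn ell.

Let ell_cvg : ell @ \oo --> lam /\ forall n, (s <= n)%N -> lam <= ell n.
Proof.
(* [ell] is known to be nonincreasing only from index [s] on, hence the shift. *)
pose v n := ell (n + s)%N.
have vdec : {homo v : n m / (n <= m)%N >-> m <= n}.
  by apply/nonincreasing_seqP => n; rewrite /v addSn; apply: ell_anti; apply: leq_addl.
have vc : cvgn v.
  apply: nonincreasing_is_cvgn => //; exists 0 => _ [n _ <-].
  by rewrite /v divr_ge0 // lex_ge0 // leq_addl.
have ec : ell @ \oo --> limn v by rewrite -(cvg_shiftn s); exact: vc.
have lE : lam = limn v by apply: cvg_lim => //; exact: ec.
split; first by rewrite lE.
by move=> n sn; rewrite lE -(subnK sn); apply: (nonincreasing_cvgn_ge vdec vc).
Qed.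

Lemma exPiE : exPi R s Q = expR lam.
Proof.
apply: cvg_lim => //.
have c : (expR \o ell) @ \oo --> expR lam.
  by apply: cvg_comp ell_cvg.1 _; apply: continuous_expR.
apply: cvg_trans c; apply: near_eq_cvg; near=> n.
have sn : (s <= n)%N by near: n; apply: nbhs_infty_ge.
rewrite /powR /= pnatr_eq0 gtn_eqF ?exPi_n_gt0 ?s2//.
by rewrite /ell mulrC.
Unshelve. all: by end_near. Qed.

Let b n : R := #|sq_set 'I_n s q|%:R.

Lemma ln_card_ge_rate n : (s <= n)%N -> 'C(n, 2)%:R * lam <= ln (b n).
Proof.
move=> sn; have c0 : (0 : R) < 'C(n, 2)%:R by rewrite ltr0n bin_gt0 (leq_trans s2).
rewrite mulrC -ler_pdivlMr //; apply: le_trans (ell_cvg.2 _ sn) _.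
rewrite ler_pM2r ?invr_gt0// ler_ln ?posrE ?ltr0n ?exPi_n_gt0 ?s2 ?sq_set_card_gt0//.
by rewrite ler_nat exPi_n_le_card ?s2.
Qed.

(** The parameters of [ln_card_sq_set_le] are chosen in the order [k], [d], [M], [n]; each is
    responsible for an error of at most [eta / 4]. *)
Lemma ln_card_le_rate_near (eta : R) : 0 < eta ->
  \forall n \near \oo, ln (b n) <= 'C(n, 2)%:R * (lam + eta).
Proof.
move=> e0; have [ec _] := ell_cvg.
have : \forall k \near \oo, (s <= k)%N /\ ell k <= lam + eta / 4.
  near=> k; split; first by near: k; apply: nbhs_infty_ge.
  near: k; apply: (cvgr_le lam ec); lra.
move=> [k0 _ /(_ k0 (leqnn _))] [sk ek].
set k := k0 in sk ek.
have [d d0 [dq de]] : exists2 d : R, 0 < d & d * q.+1%:R <= 1 /\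
    q.+1%:R * (d + 2 * Num.sqrt d) <= eta / 4.
  (* With [d = c ^+ 2] and [c <= 1], [d + 2 * sqrt d] is at most [3 * c], whence the constant 12. *)
  pose c := Num.min (q.+1%:R^-1) (eta / (12 * q.+1%:R)).
  have q0 : (0 : R) < q.+1%:R by [].
  have c0 : 0 < c by rewrite lt_min invr_gt0 q0 divr_gt0 // mulr_gt0.
  have c1 : c * q.+1%:R <= 1 by rewrite -ler_pdivlMr // div1r ge_min lexx.
  have c2 : c * (12 * q.+1%:R) <= eta by rewrite -ler_pdivlMr ?mulr_gt0// ge_min lexx orbT.
  have c3 : c <= 1 by apply: le_trans c1; rewrite ler_peMr ?ler1n// ltW.
  exists (c ^+ 2); first by rewrite exprn_gt0.
  rewrite sqrtr_sqr gtr0_norm // expr2; split; nra.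
set w := 'C(k, 2)%:R * ln q.+1%:R ^+ 2 / d ^+ 'C(k, 2) : R.
have [M M0 Mw] : exists2 M, (0 < M)%N & w / M%:R <= eta / 4.
  have w0 : 0 <= w.
    by rewrite /w divr_ge0 ?mulr_ge0 ?exprn_ge0 ?ln_ge0 ?ler1n// ltW.
  have x0 : 0 <= 4 * w / eta by rewrite divr_ge0 ?(ltW e0)// mulr_ge0.
  have := archi_boundP x0; set M := Num.bound _ => Mw.
  have M0 : (0 : R) < M%:R by apply: le_lt_trans Mw.
  exists M; first by rewrite -(ltr0n R).
  by move: Mw; rewrite ltr_pdivrMr // ler_pdivrMr //; nra.
near=> n.
have sn : (s <= n)%N by near: n; apply: nbhs_infty_ge.
have Mn : (M * k + 2 <= n)%N by near: n; apply: nbhs_infty_ge.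
(* The factor 8 is 4, from [eta / 4], times 2, from [2 * 'C(n, 2) = n.-1 * n]. *)
have x0 : 0 <= (M * k)%:R * ln q.+1%:R * 8 / eta.
  by rewrite divr_ge0 ?(ltW e0)// !mulr_ge0 // ln_ge0 // ler1n.
have nl : (M * k)%:R * ln q.+1%:R * 8 / eta <= (n.-1)%:R :> R.
  apply: le_trans (ltW (archi_boundP x0)) _; rewrite ler_nat.
  suff : ((Num.bound ((M * k)%:R * ln q.+1%:R * 8 / eta : R)).+1 <= n)%N by lia.
  by near: n; apply: nbhs_infty_ge.
have sk2 : (2 <= s <= k)%N by rewrite s2.
apply: (le_trans (ln_card_sq_set_le sk2 M0 Mn d0 dq)).
have bn : 2 * 'C(n, 2)%:R = (n.-1)%:R * n%:R :> R.
  by rewrite -!natrM mul_bin_left bin1 subn1.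
move: nl; rewrite ler_pdivrMr // => nl.
have nl' : (M * k * n)%:R * ln q.+1%:R <= 'C(n, 2)%:R * (eta / 4) :> R.
  rewrite natrM -(ler_pM2l (_ : 0 < 8)) //.
  have -> : 8 * ((M * k)%:R * n%:R * ln q.+1%:R) =
      n%:R * ((M * k)%:R * ln q.+1%:R * 8) :> R by ring.
  have -> : 8 * ('C(n, 2)%:R * (eta / 4)) = n%:R * ((n.-1)%:R * eta) :> R.
    by rewrite (_ : 8 = 4 * 2) -?mulrA ?(mulrA 2) ?bn; [field|rewrite -natrM].
  by rewrite ler_wpM2l.
apply: (le_trans (lerD nl' (lexx _))); rewrite -mulrDr ler_wpM2l //.
rewrite -/Q -/(lex k) -/(ell k) -/w; lra.
Unshelve. all: by end_near. Qed.

End Counting.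

(** * From the growth rate to the asymptotic counts *)

Unset Implicit Arguments.

Theorem theorem2p2 (R : realType) (s q : nat) (hs : (2 <= s)%N) :
  let Q := (q + 'C(s, 2))%N in
  (1 < exPi R s Q ->
     (forall n : nat,
        ((exPi R s Q ^+ 'C(n, 2))%:E <= counting (sq_graphs n s q))%E) /\
     (exists2 eps : nat -> R, eps =o_\oo (fun=> 1 : R) &
        \forall n \near \oo,
          (counting (sq_graphs n s q) <=
             (exPi R s Q `^ ((1 + eps n) * 'C(n, 2)%:R))%:E)%E)) /\
  (exPi R s Q <= 1 ->
     exists2 f : nat -> R, f =o_\oo (fun n : nat => n%:R ^+ 2 : R) &
       \forall n \near \oo,
         (counting (sq_graphs n s q) <= (2 `^ f n)%:E)%E).
Proof.
move=> Q; rewrite /Q (exPiE R q hs); set lam := limn _.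
have ln_card_ge_rate' := ln_card_ge_rate R q hs.
have ln_card_le_rate_near' := @ln_card_le_rate_near R s q hs.
rewrite -/lam in ln_card_ge_rate' ln_card_le_rate_near'.
have b0 n : (0 : R) < #|sq_set 'I_n s q|%:R by rewrite ltr0n sq_set_card_gt0.
split=> [lam1|lam1].
  have lam0 : 0 < lam by move: lam1; rewrite -expR0 ltr_expR.
  split=> [n|].
    have [sn|ns] := leqP s n.
      rewrite counting_sq_graphs // lee_fin -expRM_natl -[X in _ <= X]lnK ?posrE//.
      by rewrite ler_expR ln_card_ge_rate'.
    have [n2|n2] := leqP 2 n; first by rewrite counting_sq_graphs_small ?n2 ?leey.
    (* For [n < 2] the exponent is 0, and the zero multigraph shows that there is at least one
       graph. *)
    rewrite bin_small // expr0 /counting; case: ifPn => [/asboolP fin|_]; last by rewrite leey.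
    rewrite lee_fin ler1n lt0n size_eq0; apply/eqP => E.
    have : ([ffun=> 0%N] : multigraph 'I_n) \in fset_set (sq_graphs n s q).
      by rewrite in_fset_set //; apply: mem_set => X _; rewrite big1 // => e _; rewrite ffunE.
    by rewrite -topredE /= /finmap.pred_of_finset E.
  (* This [eps] turns the upper bound into an equality; it is nonnegative for [n >= s] by the lower
     bound. *)
  exists (fun n => ln #|sq_set 'I_n s q|%:R / ('C(n, 2)%:R * lam) - 1).
    apply/eqoP => e e0; near=> n.
    have sn : (s <= n)%N by near: n; apply: nbhs_infty_ge.
    have c0 : (0 : R) < 'C(n, 2)%:R by rewrite ltr0n bin_gt0 (leq_trans hs).
    rewrite normr1 mulr1 ger0_norm; last first.
      by rewrite subr_ge0 ler_pdivlMr ?mulr_gt0// mul1r ln_card_ge_rate'.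
    rewrite lerBlDr ler_pdivrMr ?mulr_gt0//.
    have -> : (e + 1) * ('C(n, 2)%:R * lam) = 'C(n, 2)%:R * (lam + e * lam) by ring.
    by near: n; apply: ln_card_le_rate_near'; rewrite mulr_gt0.
  near=> n.
  have sn : (s <= n)%N by near: n; apply: nbhs_infty_ge.
  have c0 : (0 : R) < 'C(n, 2)%:R by rewrite ltr0n bin_gt0 (leq_trans hs).
  rewrite counting_sq_graphs // lee_fin -expRM.
  have -> : lam * ((1 + (ln #|sq_set 'I_n s q|%:R / ('C(n, 2)%:R * lam) - 1)) * 'C(n, 2)%:R) =
    ln #|sq_set 'I_n s q|%:R by field; rewrite !gt_eqF.
  by rewrite lnK ?posrE.
have lam0 : lam <= 0 by move: lam1; rewrite -expR0 ler_expR.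
have ln2 : 0 < ln 2 :> R by rewrite ln_gt0 // ltr1n.
(* The base 2 logarithm of the count, which is small against [n ^ 2] because [lam <= 0]. *)
exists (fun n => ln #|sq_set 'I_n s q|%:R / ln 2).
  apply/eqoP => e e0; near=> n.
  rewrite !ger0_norm ?exprn_ge0// ?divr_ge0 ?(ltW ln2)// ?ln_ge0 ?ler1n ?sq_set_card_gt0//.
  rewrite ler_pdivrMr // mulrAC.
  apply: (@le_trans _ _ ('C(n, 2)%:R * (lam + e * ln 2))).
    by near: n; apply: ln_card_le_rate_near'; rewrite mulr_gt0.
  apply: (@le_trans _ _ ('C(n, 2)%:R * (e * ln 2))).
    by rewrite ler_wpM2l // gerDr.
  rewrite mulrC ler_wpM2l ?mulr_ge0 ?(ltW e0) ?(ltW ln2)//.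
  by rewrite -natrX ler_nat bin2; lia.
near=> n.
have sn : (s <= n)%N by near: n; apply: nbhs_infty_ge.
rewrite counting_sq_graphs // lee_fin /powR pnatr_eq0 /= divfK ?gt_eqF// lnK ?posrE//.
Unshelve. all: by end_near. Qed.
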